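(* Let \begin{align*} A(q,x,y) &:= \sum_{k\geq 1}\sum_{n} A_{k,n}(q)\, x^n y^k, \qquad A_k(q,x):=\sum_n A_{k,n}(q)\,x^n . \end{align*} Then \begin{align*} A(q,x,y) & = \frac{-y}{q(1-x)} + \sum_{i \geq 1} \frac{y^i (q^{2i+1} -y)} {q^{i^2+i+1} (q^i - q^i [i+1] x +[i]xy)} \\ A_k(q,x) &= \sum_{i=0}^{k-1} (-1)^{i+k} \frac{x^{k-i-1}[i]^{k-i-1}}{q^{ki+i+1}(1-[i+1]x)^{k-i}} + \sum_{i=0}^k (-1)^{i+k} \frac{x^{k-i}[i]^{k-i}}{q^{ki}(1-[i+1]x)^{k-i+1}} \\ A_{k,n}(q) &= q^{-k^2} \sum_{i=0}^{k-1} (-1)^i {n \choose i} (q^{ki} [k-i]^i [k-i+1]^{n-i} - q^{(k+1)i} [k-i-1]^i [k-i]^{n-i})\\ &= \sum_{i=0}^{k-1} {n \choose i} q^{-(k-i)^2} ([i-k]^i [k-i+1]^{n-i} - [i-k+1]^i [k-i]^{n-i}). \end{align*}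
   Context: The totally nonnegative part of the Grassmannian is $Gr_{k,n}^{+} = \mathrm{GL}_k^{+} \backslash \mathrm{Mat}^{+}(k,n)$, where $\mathrm{Mat}^{+}(k,n)$ is the space of real $k\times n$ matrices of rank $k$ with nonnegative maximal minors and $\mathrm{GL}_k^{+}$ is the group of real $k\times k$ matrices with positive determinant. Specifying which maximal minors are strictly positive and which are zero gives a cell decomposition of $Gr_{k,n}^{+}$ (Postnikov). The rank generating function $A_{k,n}(q)$ is the polynomial in $q$ whose coefficient of $q^r$ is the number of cells of dimension $r$ in this decomposition of $Gr_{k,n}^{+}$ (equivalently, the number of fillings of Young diagrams of partitions $\lambda$ contained in a $k\times(n-k)$ rectangle by $0$'s and $1$'s with no $0$ having a $1$ above it in its column and a $1$ to its left in its row, counted by their number of $1$'s, which is $r$). Here $[i]=1+q+\dots+q^{i-1}$ denotes the $q$-analog of $i$. The expression $\frac{1}{q^i - q^i[i+1]x + [i]xy}$ is shorthand for the formal power series obtained by expanding $\frac{1}{q^i (1-[i+1]x)\left(1 - \frac{q^{-i}[i]y}{1-[i+1]x}\right)}$.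
   Formalization: The fraction 1/(q^i - q^i[i+1]x + [i]xy) is its true power series inverse, with factor 1 + q^{-i}[i]xy/(1-[i+1]x) in place of the stated 1 - q^{-i}[i]y/(1-[i+1]x); with the latter the x^0y^2 coefficient would be q^{-2}, not 0. *)

(* Defs.v *)
From HB Require Import structures.
From mathcomp Require Import all_boot all_order all_algebra.
Set Implicit Arguments. Unset Strict Implicit. Unset Printing Implicit Defensive.
Import GRing.Theory.
Local Open Scope ring_scope.

Definition qnat (R : nzRingType) (q : R) (i : nat) : R := \sum_(j < i) q ^+ j.

(* q-analog of an integer: [m] = (1 - q^m)/(1 - q), i.e. for m = -(n+1) < 0,
   [m] = -(q^-1 + ... + q^-(n+1)). *)
Definition qint (R : unitRingType) (q : R) (m : int) : R :=
  match m with
  | Posz n => qnat q n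
  | Negz n => - \sum_(j < n.+1) q ^- j.+1
  end.

(* A partition in the k x m rectangle: row lengths lam 0 >= lam 1 >= ... (English notation,
   row 0 on top, rows left-justified). *)
Definition is_partition (k m : nat) (lam : {ffun 'I_k -> 'I_m.+1}) : bool :=
  [forall i : 'I_k, forall i' : 'I_k, (i <= i')%N ==> (lam i' <= lam i)%N].

Definition in_diagram (k m : nat) (lam : {ffun 'I_k -> 'I_m.+1}) (b : 'I_k * 'I_m) : bool :=
  (b.2 < lam b.1)%N.

(* f b = true means box b is filled with 1; boxes outside the diagram carry no entry
   (encoded as false). Le-condition: no 0 has both a 1 above it in its column and a 1
   to its left in its row. *)
Definition is_Le_filling (k m : nat) (lam : {ffun 'I_k -> 'I_m.+1})
    (f : {ffun 'I_k * 'I_m -> bool}) : bool :=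
  [forall b, (~~ in_diagram lam b) ==> ~~ f b] &&
  [forall b, (in_diagram lam b && ~~ f b) ==>
      ~~ ([exists i' : 'I_k, (i' < b.1)%N && f (i', b.2)] &&
          [exists j' : 'I_m, (j' < b.2)%N && f (b.1, j')])].

Definition num_ones (k m : nat) (f : {ffun 'I_k * 'I_m -> bool}) : nat :=
  #|[pred b | f b]|.

Definition Le_genpoly (R : nzRingType) (k m : nat) : {poly R} :=
  \sum_(lam : {ffun 'I_k -> 'I_m.+1} | is_partition lam)
    \sum_(f : {ffun 'I_k * 'I_m -> bool} | is_Le_filling lam f) 'X^(num_ones f).

(* A_{k,n}(q): rank generating function of the cell decomposition of Gr^+_{k,n};
   0 when k > n (empty Grassmannian). *)
Definition Akn (R : nzRingType) (k n : nat) : {poly R} :=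
  if (k <= n)%N then Le_genpoly R k (n - k) else 0.

Definition psmul (R : nzRingType) (a b : nat -> R) : nat -> R :=
  fun n => \sum_(j < n.+1) a j * b (n - j)%N.
Definition psone (R : nzRingType) : nat -> R := fun n => (n == 0%N)%:R.
Definition psexp (R : nzRingType) (a : nat -> R) (r : nat) : nat -> R :=
  iter r (psmul a) (@psone R).
Definition psX (R : nzRingType) (m : nat) : nat -> R := fun n => (n == m)%:R.
Definition geom (R : nzRingType) (c : R) : nat -> R := fun n => c ^+ n.

(* ---------- formal power series in x, y : a n k = coefficient of x^n y^k ---------- *)
Definition bmul (R : nzRingType) (a b : nat -> nat -> R) : nat -> nat -> R :=
  fun n k => \sum_(n1 < n.+1) \sum_(k1 < k.+1) a n1 k1 * b (n - n1)%N (k - k1)%N.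
Definition bY (R : nzRingType) (m : nat) : nat -> nat -> R :=
  fun n k => ((n == 0%N) && (k == m))%:R.
Definition bconst (R : nzRingType) (c : R) : nat -> nat -> R :=
  fun n k => if (n == 0%N) && (k == 0%N) then c else 0.
Definition bofx (R : nzRingType) (a : nat -> R) : nat -> nat -> R :=
  fun n k => if k == 0%N then a n else 0.

(* 1/(q^i - q^i [i+1] x + [i] x y): the (unique) inverse of this bivariate series, whose
   constant term q^i is invertible.  Writing c = [i+1], it expands as
   1/(q^i (1-c x) (1 + q^-i [i] x y/(1-c x)))
   = q^-i sum_m (- q^-i [i])^m x^m y^m (1-c x)^-(m+1),
   so its coefficient of x^n y^k is q^-i (-q^-i [i])^k [x^n] x^k (1-c x)^-(k+1). *)
Definition Ginv (R : unitRingType) (q : R) (i : nat) : nat -> nat -> R :=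
  fun n k => q ^- i * (- (q ^- i * qnat q i)) ^+ k *
             psmul (psX R k) (psexp (geom (qnat q i.+1)) k.+1) n.

(* Main.v *)
Require Import Defs.
From HB Require Import structures.
From mathcomp Require Import all_boot all_order all_algebra.
From mathcomp Require Import ring zify.
Set Implicit Arguments. Unset Strict Implicit. Unset Printing Implicit Defensive.
Import GRing.Theory.
Local Open Scope ring_scope.

(** Build a Le-diagram along its boundary path, from the north-east corner:
    each step adds an empty row at the bottom or a full column on the left.
    Call a row unrestricted if none of its 0's has a 1 above it; a new column
    may have a 1 only in unrestricted rows, and an unrestricted row becomes
    restricted exactly when it receives a 0 below a 1.  Weighting every
    unrestricted row by [t], a new row multiplies by [t] and a new column maps
    [t^u] to [t^u + q t ((1 + q t)^u - t^u) / (1 + (q - 1) t)].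

    At [t = [i]] one has [1 + q t = [i + 1]] and [1 + (q - 1) t = q^i], so the
    generating polynomials [P_n(i)] in [y], which marks rows, satisfy
      [P_(n+1)(i) = ([i] y - q^(1-i) [i-1]) P_n(i) + q^(1-i) [i] P_n(i+1)].
    This recursion has eigenvalues [mu_j = [j+1] - q^(-j) [j] y], with
    eigenvectors [eigcoef] divisible by [y^j], and the initial value 1 is the
    [y]-adically convergent sum of these eigenvectors.  Hence [P_n(1)] is the
    sum over [j] of [y^j q^(-j^2) (1 - y q^(-2j-1)) mu_j^n], and all the
    formulas are read off from its coefficients. *)

(** * q-analogs *)

Section QNumbers.
Variables (F : fieldType) (q : F).

Lemma qnat0 : qnat q 0 = 0. Proof. by rewrite /qnat big_ord0. Qed.
Lemma qnatS n : qnat q n.+1 = qnat q n + q ^+ n.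
Proof. by rewrite /qnat big_ord_recr. Qed.
Lemma qnatD m n : qnat q (m + n) = qnat q m + q ^+ m * qnat q n.
Proof.
elim: n => [|n IH]; first by rewrite addn0 qnat0 mulr0 addr0.
by rewrite addnS !qnatS IH mulrDr -exprD addrA.
Qed.
Lemma qnat1 : qnat q 1 = 1. Proof. by rewrite qnatS qnat0 add0r. Qed.
Lemma qnatS_l n : qnat q n.+1 = 1 + q * qnat q n.
Proof. by rewrite -add1n qnatD qnat1 expr1. Qed.
(** The geometric sum with its denominator cleared, so that q = 1 is included. *)
Lemma qnat_geom n : 1 + (q - 1) * qnat q n = q ^+ n.
Proof.
elim: n => [|n IH]; first by rewrite qnat0 mulr0 addr0.
by rewrite qnatS mulrDr addrA IH exprS; ring.
Qed.

(* [qbinom a b] is the Gaussian binomial coefficient [a + b choose b]. *)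
Fixpoint qbinom (a b : nat) {struct a} : F :=
  if a is a'.+1 then
    (fix qb (b : nat) : F :=
       if b is b'.+1 then qb b' + q ^+ b'.+1 * qbinom a' b else 1) b
  else 1.

Lemma qbinom0r a : qbinom a 0 = 1. Proof. by case: a. Qed.
Lemma qbinomSS a b :
  qbinom a.+1 b.+1 = qbinom a.+1 b + q ^+ b.+1 * qbinom a b.+1.
Proof. by []. Qed.
Lemma qbinomSS' a b :
  qbinom a.+1 b.+1 = qbinom a b.+1 + q ^+ a.+1 * qbinom a.+1 b.
Proof.
elim: a b => [|a IHa] b.
  elim: b => [|b IHb]; first by rewrite /= expr1.
  by rewrite qbinomSS {1}IHb qbinomSS [qbinom 0 _]/= [qbinom 0 _]/= !exprS; ring.
elim: b => [|b IHb].
  by rewrite qbinomSS {1}IHa [qbinom a.+1 1 in RHS]qbinomSS !qbinom0r !exprS; ring.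
have -> : qbinom a.+1 b.+2 + q ^+ a.+2 * qbinom a.+2 b.+1 =
    qbinom a.+1 b.+1 + q ^+ b.+2 * qbinom a b.+2 +
    q ^+ a.+2 * (qbinom a.+2 b + q ^+ b.+1 * qbinom a.+1 b.+1) by [].
by rewrite qbinomSS IHb (IHa b.+1) !exprS; ring.
Qed.
Lemma qbinomC a b : qbinom a b = qbinom b a.
Proof.
elim: a b => [|a IHa] b; first by rewrite qbinom0r.
elim: b => [|b IHb] //.
by rewrite qbinomSS qbinomSS' IHb IHa.
Qed.
Lemma qbinom_absorb a b :
  qnat q a.+1 * qbinom a.+1 b = qnat q (a.+1 + b) * qbinom a b.
Proof.
(* Induction on [a + b], since the hypothesis is also used with the two arguments exchanged, by
   symmetry of [qbinom]; this makes both Pascal terms multiples of [qbinom a b.+1]. *)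
move: {2}(a + b)%N (leqnn (a + b)) => N; elim: N a b => [|N IH] a [|b] leN;
  rewrite ?qbinom0r ?addn0 //; first by rewrite addnS in leN.
have ab : (a + b <= N)%N by rewrite addnS in leN.
rewrite qbinomSS mulrDr IH // mulrCA.
have := IH b a; rewrite addnC ab => /(_ isT).
rewrite qbinomC (qbinomC b) addSn addnC -addSn => <-.
by rewrite (addnC a.+1) qnatD; ring.
Qed.

End QNumbers.

(** * The eigenvector expansion *)

Section Spectral.
Variables (F : fieldType) (q : F).
Hypothesis q_neq0 : q != 0.

Definition mu (j : nat) : {poly F} :=
  (qnat q j.+1)%:P - (q ^- j * qnat q j)%:P * 'X.

(** With y for ['X], the q-Pochhammer symbol (q^(-j) y; q)_m. *)
Definition qpoch (m j : nat) : {poly F} :=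
  \prod_(l < m) (1 - (q ^+ l * q ^- j)%:P * 'X).

(* The index [m] stands for [t = [m + 1]]. *)
Definition eigcoef (m j : nat) : {poly F} :=
  (q ^- (j * j))%:P * 'X^j * (1 - (q ^- (2 * j + 1))%:P * 'X)
  * (qbinom q m j)%:P * qpoch m j.

Lemma qpochSr m j : qpoch m.+1 j = qpoch m j * (1 - (q ^+ m * q ^- j)%:P * 'X).
Proof. by rewrite /qpoch big_ord_recr. Qed.

Lemma qpochSS m j : qpoch m.+1 j.+1 = (1 - (q ^- j.+1)%:P * 'X) * qpoch m j.
Proof.
rewrite /qpoch big_ord_recl expr0 mul1r; congr (_ * _).
apply: eq_bigr => l _; rewrite /= /bump /= ?add1n.
by congr (1 - _%:P * _); rewrite !exprS invfM mulrACA divff ?mul1r.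
Qed.

(* A Wilf-Zeilberger certificate, found from its values at [m = 0]. *)
Definition eigcert (m j : nat) : {poly F} :=
  if j is j'.+1 then
    (q ^- (j * j) * q ^+ m.+1 * qbinom q m.+1 j')%:P * 'X^j * qpoch m.+1 j
  else 0.

(** What is left of the telescoping identity once its common factor is removed; the two hypotheses
    compare the coefficients of y and y^2. *)
Lemma eigcoef_telescope_aux (y : {poly F}) (e1 e2 e4 e5 b d : F) :
  e4 = e1 * (b - d) + e2 * d -> e4 * e5 = e1 * e2 * b ->
  (1 - e1%:P * y) * (b%:P * (1 - e2%:P * y) - d%:P) =
  (b - d)%:P * (1 - e2%:P * y) - e4%:P * y * (1 - e5%:P * y).
Proof.
move=> h1 h2.
have -> : e4%:P * y * (1 - e5%:P * y) = e4%:P * y - (e4 * e5)%:P * y * y by ring.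
by rewrite h2 h1; ring.
Qed.

Lemma eigcoef_telescope m j :
  eigcoef m.+1 j - eigcoef m j = eigcert m j - eigcert m j.+1.
Proof.
set b := qbinom q m.+1 j; set d := qbinom q m j.
(* The value 0 at [j = 0] lets both q-Pascal rules, [hb] and [hd], hold for every [j]. *)
pose c := if j is j'.+1 then qbinom q m.+1 j' else 0.
have hb : b - d = q ^+ m.+1 * c.
  rewrite /b /d /c; case: (j) => [|j']; first by rewrite !qbinom0r subrr mulr0.
  by rewrite qbinomSS' addrAC subrr add0r.
have hd : d = q ^- j * (b - c).
  rewrite /b /d /c; case: (j) => [|j'].
    by rewrite !qbinom0r expr0 invr1 mul1r subr0.
  by rewrite qbinomSS addrAC subrr add0r mulKf // expf_neq0.
have -> : eigcert m j =
    (q ^- (j * j))%:P * 'X^j * qpoch m j *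
      ((b - d)%:P * (1 - (q ^+ m * q ^- j)%:P * 'X)).
  rewrite hb /eigcert /c; case: (j) => [|j']; first by rewrite !mulr0 mul0r mulr0.
  by rewrite qpochSr; ring.
pose e4 := q ^- (2 * j + 1) * q ^+ m.+1 * b.
have -> : eigcert m j.+1 =
    (q ^- (j * j))%:P * 'X^j * qpoch m j *
      (e4%:P * 'X * (1 - (q ^- j.+1)%:P * 'X)).
  rewrite /eigcert qpochSS -/b.
  have -> : q ^- (j.+1 * j.+1) = q ^- (j * j) * q ^- (2 * j + 1).
    by rewrite -invfM -exprD; congr (_ ^- _); lia.
  by rewrite /e4 (exprS 'X); ring.
rewrite -mulrBr -(@eigcoef_telescope_aux _ (q ^- (2 * j + 1))) /eigcoef -/b -/d ?qpochSr.
- by ring.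
- rewrite hb hd /e4.
  rewrite mul2n -addnn !exprD !exprS expr0.
  have : q ^+ j != 0 by rewrite expf_neq0.
  move=> hj; field; rewrite q_neq0 hj //.
- rewrite /e4 !exprS mul2n -addnn !exprD.
  have : q ^+ j != 0 by rewrite expf_neq0.
  by move=> hj; field; rewrite q_neq0 hj.
Qed.

(** By [qbinom_absorb], the second term is eigcoef m j times q^(-m) [m+1+j] (1 - q^(m-j) y), so only
    an identity of polynomials of degree 1 in y remains. *)
Lemma eigcoef_rec m j :
  ((qnat q m.+1)%:P * 'X - (q ^- m * qnat q m)%:P) * eigcoef m j
  + (q ^- m * qnat q m.+1)%:P * eigcoef m.+1 j = mu j * eigcoef m j.
Proof.
have qm : q ^+ m != 0 by rewrite expf_neq0.
have qj : q ^+ j != 0 by rewrite expf_neq0.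
rewrite /eigcoef qpochSr.
set X1 := (q ^- (j * j))%:P * _ * _.
have -> : (q ^- m * qnat q m.+1)%:P * (X1 * (qbinom q m.+1 j)%:P *
    (qpoch m j * (1 - (q ^+ m * q ^- j)%:P * 'X))) =
  (q ^- m * (qnat q m.+1 * qbinom q m.+1 j))%:P * X1 * qpoch m j *
    (1 - (q ^+ m * q ^- j)%:P * 'X) by ring.
rewrite qbinom_absorb.
have -> : mu j = (qnat q m.+1)%:P * 'X - (q ^- m * qnat q m)%:P +
   (q ^- m * qnat q (m.+1 + j))%:P * (1 - (q ^+ m * q ^- j)%:P * 'X).
  rewrite mulrBr mulr1 mulrA -polyCM.
  have -> : q ^- m * qnat q (m.+1 + j) * (q ^+ m * q ^- j) =
      qnat q m.+1 + q ^- j * qnat q j.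
    by rewrite addnC qnatD; field; rewrite qj qm.
  have -> : q ^- m * qnat q (m.+1 + j) = q ^- m * qnat q m + qnat q j.+1.
    by rewrite addSnnS qnatD; field; rewrite qm.
  by rewrite /mu; ring.
by ring.
Qed.

(** At m = 0 the partial sums telescope, with remainder q^(-(J+1)^2) y^(J+1). Passing from m to m +
    1 changes the remainder by [eigcert m J.+1], again divisible by y^(J+1). *)
Lemma sum_eigcoef m J :
  'X^(J.+1) %| 1 - \sum_(j < J.+1) eigcoef m j.
Proof.
elim: m => [|m IH].
  suff -> : 1 - \sum_(j < J.+1) eigcoef 0 j = (q ^- (J.+1 * J.+1))%:P * 'X^(J.+1).
    by rewrite dvdp_mull.
  elim: J => [|J IHJ].
    rewrite big_ord1 /eigcoef /qpoch big_ord0 !mul0n muln0 add0n mul1n ?expr0 expr1 invr1 /=.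
    by ring.
  rewrite big_ord_recr opprD addrA IHJ /= /eigcoef /qpoch big_ord0 /=.
  rewrite [in RHS](_ : J.+2 * J.+2 = J.+1 * J.+1 + (2 * J.+1 + 1))%N; last by lia.
  by rewrite (exprD q (J.+1 * J.+1)) invfM [in RHS](exprS 'X); ring.
have -> : 1 - \sum_(j < J.+1) eigcoef m.+1 j =
   (1 - \sum_(j < J.+1) eigcoef m j) + eigcert m J.+1.
  have -> : eigcert m J.+1 =
      - \sum_(j < J.+1) (eigcoef m.+1 j - eigcoef m j).
    under eq_bigr => j _ do rewrite eigcoef_telescope.
    by rewrite sumrB -opprB -sumrB -(big_mkord xpredT (fun j => eigcert m j.+1 - eigcert m j)) telescope_sumr // subr0 opprK.
  by rewrite sumrB; ring.
by rewrite dvdp_add // /eigcert mulrAC dvdp_mull.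
Qed.

(** The truncated eigenvector sums obey the recursion of [P] exactly, so the initial error modulo
    y^(J+1) propagates linearly and stays divisible by y^(J+1). *)
Lemma eigen_expansion (P : nat -> nat -> {poly F}) :
  (forall m, P 0%N m = 1) ->
  (forall n m, P n.+1 m =
     ((qnat q m.+1)%:P * 'X - (q ^- m * qnat q m)%:P) * P n m
     + (q ^- m * qnat q m.+1)%:P * P n m.+1) ->
  forall J n m, 'X^(J.+1) %| P n m - \sum_(j < J.+1) eigcoef m j * mu j ^+ n.
Proof.
move=> P0 PS J; elim=> [|n IH] m.
  by under eq_bigr do rewrite expr0 mulr1; rewrite P0 sum_eigcoef.
rewrite PS.
set L := ((qnat q m.+1)%:P * 'X - _); set K := (q ^- m * qnat q m.+1)%:P.
have -> : \sum_(j < J.+1) eigcoef m j * mu j ^+ n.+1 =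
    L * (\sum_(j < J.+1) eigcoef m j * mu j ^+ n)
    + K * (\sum_(j < J.+1) eigcoef m.+1 j * mu j ^+ n).
  rewrite !mulr_sumr -big_split; apply: eq_bigr => j _ /=.
  by rewrite (mulrA L) (mulrA K) -mulrDl eigcoef_rec exprS; ring.
rewrite opprD addrACA -!mulrBr.
by rewrite dvdp_add // dvdp_mull.
Qed.

Lemma coef_mu_exp j n r :
  (mu j ^+ n)`_r =
  'C(n, r)%:R * qnat q j.+1 ^+ (n - r) * (- (q ^- j * qnat q j)) ^+ r.
Proof.
have -> : mu j = (qnat q j.+1)%:P + (- (q ^- j * qnat q j))%:P * 'X.
  by rewrite polyCN mulNr.
rewrite exprDn coef_sum.
have E (i : 'I_n.+1) : ((qnat q j.+1)%:P ^+ (n - i) *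
   ((- (q ^- j * qnat q j))%:P * 'X) ^+ i *+ 'C(n, i))`_r =
   if r == i then 'C(n, i)%:R * qnat q j.+1 ^+ (n - i) * (- (q ^- j * qnat q j)) ^+ i else 0.
  rewrite coefMn exprMn -!rmorphXn mulrA -rmorphM coefCM coefXn.
  by case: eqP => _; rewrite ?mulr0 ?mul0rn // mulr1 -[LHS]mulr_natl mulrA.
under eq_bigr => i _ do rewrite E.
rewrite -big_mkcond /=.
case: (leqP r n) => rn.
  by rewrite (big_pred1 (Ordinal (rn : (r < n.+1)%N))) // => i; rewrite eq_sym.
rewrite bin_small // !mul0r big_pred0 // => i.
by apply/eqP => ri; move: (ltn_ord i); rewrite -ri ltnNge rn.
Qed.

Lemma coef_eigen_expansion (P : nat -> nat -> {poly F}) :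
  (forall m, P 0%N m = 1) ->
  (forall n m, P n.+1 m =
     ((qnat q m.+1)%:P * 'X - (q ^- m * qnat q m)%:P) * P n m
     + (q ^- m * qnat q m.+1)%:P * P n m.+1) ->
  forall n k, (P n 0%N)`_k =
    \sum_(j < k.+1) q ^- (j * j) * (mu j ^+ n)`_(k - j)
    - \sum_(j < k) q ^- (j * j + 2 * j + 1) * (mu j ^+ n)`_(k - j - 1).
Proof.
move=> P0 PS n k.
(* Truncation after index [k] leaves a multiple of y^(k+1), invisible at y^k. *)
have /dvdpP [r /(canRL (subrK _)) ->] := eigen_expansion P0 PS k n 0.
rewrite coefD coefMXn ltnS leqnn add0r coef_sum.
(* The second sum gets a term [j = k], so that the two sums merge. It must be forced to 0, because
   the truncated [k - j - 1] is 0 there. *)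
rewrite [X in _ - X](_ : _ = \sum_(j < k.+1) q ^- (j * j + 2 * j + 1) *
    (if (k - j == 0)%N then 0 else (mu j ^+ n)`_(k - j - 1))); last first.
  rewrite big_ord_recr /= subnn eqxx mulr0 addr0; apply: eq_bigr => j _.
  by rewrite subn_eq0 leqNgt ltn_ord.
rewrite -sumrB; apply: eq_bigr => -[j jk] _ /=.
rewrite /eigcoef /qpoch big_ord0 mulr1 [qbinom _ _ _]/= mulr1.
have -> : (q ^- (j * j))%:P * 'X^j * (1 - (q ^- (2 * j + 1))%:P * 'X) * mu j ^+ n
  = ((q ^- (j * j))%:P * mu j ^+ n
     - (q ^- (j * j + 2 * j + 1))%:P * (mu j ^+ n * 'X)) * 'X^j.
  by rewrite -addnA (exprD q (j * j)) invfM; ring.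
rewrite coefMXn ltnNge -ltnS jk /= coefB !coefCM coefMX.
by rewrite subn1.
Qed.

End Spectral.

(** * Splitting functions, cardinals and existentials over an ordinal at one point *)

Section FfunSplit.
Variables (n : nat) (T : finType).

Definition ffun_rcons (c : {ffun 'I_n -> T}) (x : T) : {ffun 'I_n.+1 -> T} :=
  [ffun i => if unlift ord_max i is Some i' then c i' else x].

Lemma ffun_rcons_lift c x i : ffun_rcons c x (lift ord_max i) = c i.
Proof. by rewrite ffunE liftK. Qed.

Lemma ffun_rcons_max c x : ffun_rcons c x ord_max = x.
Proof. by rewrite ffunE unlift_none. Qed.

Definition ffun_belast (g : {ffun 'I_n.+1 -> T}) : {ffun 'I_n -> T} :=
  [ffun i => g (lift ord_max i)].

Lemma ffun_rconsK c x : ffun_belast (ffun_rcons c x) = c.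
Proof. by apply/ffunP => i; rewrite ffunE ffun_rcons_lift. Qed.

Lemma ffun_belastK g : ffun_rcons (ffun_belast g) (g ord_max) = g.
Proof. by apply/ffunP => i; rewrite !ffunE; case: unliftP => [j|] ->; rewrite ?ffunE. Qed.

Lemma big_ffun_rcons (R : nmodType) (P : pred {ffun 'I_n.+1 -> T})
    (G : {ffun 'I_n.+1 -> T} -> R) :
  \sum_(g | P g) G g =
  \sum_(p : {ffun 'I_n -> T} * T | P (ffun_rcons p.1 p.2)) G (ffun_rcons p.1 p.2).
Proof.
rewrite (reindex (fun p : {ffun 'I_n -> T} * T => ffun_rcons p.1 p.2)) //=.
exists (fun g => (ffun_belast g, g ord_max)) => [[c x] _|g _] /=.
  by rewrite ffun_rconsK ffun_rcons_max.
by rewrite ffun_belastK.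
Qed.

End FfunSplit.

Lemma card_lift n (j : 'I_n.+1) (P : pred 'I_n.+1) :
  #|[pred i | P i]| = (P j + #|[pred i | P (lift j i)]|)%N.
Proof.
by rewrite -!sum1_card [in LHS]big_mkcond [in RHS]big_mkcond (bigD1_ord j) //= inE.
Qed.

Lemma exists_below_lift n (c : pred 'I_n.+1) (i : 'I_n) :
  [exists i' : 'I_n.+1, (i' < lift ord_max i)%N && c i'] =
  [exists i' : 'I_n, (i' < i)%N && c (lift ord_max i')].
Proof.
apply/existsP/existsP => -[i' /andP[lt ci]]; last first.
  by exists (lift ord_max i'); rewrite !lift_max lt ci.
move: lt ci; case: (unliftP ord_max i') => [i''|] -> lt ci.
  by exists i''; move: lt; rewrite !lift_max ci => ->.
by move: lt; rewrite lift_max /= ltnNge ltnW.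
Qed.

Lemma exists_below_max n (c : pred 'I_n.+1) :
  [exists i' : 'I_n.+1, (i' < (ord_max : 'I_n.+1))%N && c i'] =
  [exists i' : 'I_n, c (lift ord_max i')].
Proof.
apply/existsP/existsP => -[i']; last first.
  by move=> ci; exists (lift ord_max i'); rewrite lift_max ltn_ord ci.
case/andP; case: (unliftP ord_max i') => [i''|] -> lt ci; first by exists i''.
by rewrite ltnn in lt.
Qed.

(** * Filling a new column *)

Section NewColumn.
Variables (F : fieldType) (q t : F).

(* [U] is the set of rows unrestricted before the column [c] is added on the
   left; the exponent of [t] counts those still unrestricted afterwards. *)
Definition col_weight n (U : pred 'I_n) (c : {ffun 'I_n -> bool}) : F :=
  q ^+ #|[pred i | c i]| *
  t ^+ #|[pred i | U i && (c i || ~~ [exists i' : 'I_n, (i' < i)%N && c i'])]|.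

Definition col_supp n (U : pred 'I_n) (c : {ffun 'I_n -> bool}) : bool :=
  [forall i, c i ==> U i].

Definition col_nz n (c : {ffun 'I_n -> bool}) : bool := [exists i, c i].

Lemma col_supp_rcons n (U : pred 'I_n.+1) (c : {ffun 'I_n -> bool}) b :
  col_supp U (ffun_rcons c b) =
  col_supp (fun i => U (lift ord_max i)) c && (b ==> U ord_max).
Proof.
apply/forallP/andP => [H|[/forallP H b1] i].
  split; last by have := H ord_max; rewrite ffun_rcons_max.
  by apply/forallP => i; have := H (lift ord_max i); rewrite ffun_rcons_lift.
by case: (unliftP ord_max i) => [j|] ->; rewrite ?ffun_rcons_lift ?ffun_rcons_max.
Qed.

Lemma col_nz_rcons n (c : {ffun 'I_n -> bool}) b :
  col_nz (ffun_rcons c b) = col_nz c || b.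
Proof.
apply/existsP/orP => [[i]|[/existsP[i ci]|b1]].
- case: (unliftP ord_max i) => [j|] ->; rewrite ?ffun_rcons_lift ?ffun_rcons_max.
    by left; apply/existsP; exists j.
  by right.
- by exists (lift ord_max i); rewrite ffun_rcons_lift.
- by exists ord_max; rewrite ffun_rcons_max.
Qed.

(** A new bottom entry changes nothing above it, and its own row depends on the entries above only
    through whether one of them is 1. Hence [col_nz] is all the induction has to remember. *)
Lemma col_weight_rcons n (U : pred 'I_n.+1) (c : {ffun 'I_n -> bool}) b :
  col_weight U (ffun_rcons c b) =
  col_weight (fun i => U (lift ord_max i)) c *
  (q ^+ b * t ^+ (U ord_max && (b || ~~ col_nz c))).
Proof.
rewrite /col_weight !(card_lift ord_max) /= ffun_rcons_max exists_below_max.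
have -> : [exists i', ffun_rcons c b (lift ord_max i')] = col_nz c.
  by apply: eq_existsb => i; rewrite ffun_rcons_lift.
rewrite !exprD.
set x := q ^+ #|_|; set x' := q ^+ #|_|.
have -> : x' = x.
  by congr (_ ^+ _); apply: eq_card => i; rewrite !inE ffun_rcons_lift.
set y := t ^+ #|_|; set y' := t ^+ #|_|.
have -> : y' = y.
  congr (_ ^+ _); apply: eq_card => i; rewrite !inE ffun_rcons_lift exists_below_lift.
  by congr (_ && (_ || ~~ _)); apply: eq_existsb => i'; rewrite ffun_rcons_lift.
by ring.
Qed.

Lemma sum_col_zero n (U : pred 'I_n) :
  \sum_(c | col_supp U c && ~~ col_nz c) col_weight U c = t ^+ #|[pred i | U i]|.
Proof.
rewrite (big_pred1 [ffun=> false]) => [|c].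
  rewrite /col_weight eq_card0 ?mul1r => [|i]; last by rewrite !inE ffunE.
  congr (_ ^+ _); apply: eq_card => i; rewrite !inE ffunE /=.
  case: existsP => [[i']|_]; last by rewrite andbT.
  by rewrite ffunE andbF.
apply/andP/eqP => [[_ /existsPn c0]|->].
  by apply/ffunP => i; rewrite ffunE; apply/negbTE.
by split; [apply/forallP => i|apply/existsPn => i]; rewrite ffunE.
Qed.

(** Append the bottom entry. In an unrestricted row it contributes 1 + q t below a nonzero column,
    and q t below a zero one, where it must be 1; a restricted row contributes nothing new. The
    resulting recursion S_(u+1) = (1 + q t) S_u + q t t^u is solved after multiplying by (1 + q t) -
    t. *)
Lemma sum_col_nonzero n (U : pred 'I_n) :
  (1 + (q - 1) * t) * \sum_(c | col_supp U c && col_nz c) col_weight U c =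
  q * t * ((1 + q * t) ^+ #|[pred i | U i]| - t ^+ #|[pred i | U i]|).
Proof.
elim: n U => [|n IH] U.
  rewrite big_pred0 => [|c]; last first.
    by rewrite andbC; apply/negbTE; rewrite negb_and; apply/orP; left; apply/existsPn => -[].
  by rewrite eq_card0 => [|[]//]; rewrite !expr0 subrr !mulr0.
pose U' i := U (lift ord_max i).
rewrite big_ffun_rcons (card_lift ord_max).
under eq_bigl => p do rewrite col_supp_rcons col_nz_rcons.
under eq_bigr => p _ do rewrite col_weight_rcons.
rewrite -/U'; set u := #|[pred i | U (lift ord_max i)]|.
have -> : \sum_(p : {ffun 'I_n -> bool} * bool |
      (col_supp U' p.1 && (p.2 ==> U ord_max)) && (col_nz p.1 || p.2))
    col_weight U' p.1 * (q ^+ p.2 * t ^+ (U ord_max && (p.2 || ~~ col_nz p.1))) =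
  (if U ord_max then 1 + q * t else 1) *
     \sum_(c | col_supp U' c && col_nz c) col_weight U' c +
  (if U ord_max then q * t else 0) *
     \sum_(c | col_supp U' c && ~~ col_nz c) col_weight U' c.
  transitivity (\sum_(c | col_supp U' c)
     \sum_(b : bool | (b ==> U ord_max) && (col_nz c || b))
       col_weight U' c * (q ^+ b * t ^+ (U ord_max && (b || ~~ col_nz c)))).
    by rewrite pair_big_dep; apply: eq_bigl => p; rewrite andbA.
  rewrite (bigID (@col_nz n)) /=; congr (_ + _); rewrite mulr_sumr.
    apply: eq_bigr => c /andP[_ nz]; rewrite big_mkcond big_bool nz /=.
    by case: (U ord_max); rewrite /= ?expr0 ?expr1; ring.
  apply: eq_bigr => c /andP[_ /negbTE nz]; rewrite big_mkcond big_bool nz /=.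
  by case: (U ord_max); rewrite /= ?expr0 ?expr1; ring.
rewrite sum_col_zero mulrDr mulrCA IH -/u.
by case: (U ord_max); rewrite /= ?add0n ?add1n ?exprS; ring.
Qed.

Lemma sum_col n (U : pred 'I_n) :
  (1 + (q - 1) * t) * \sum_(c | col_supp U c) col_weight U c =
  (1 + (q - 1) * t) * t ^+ #|[pred i | U i]| +
  q * t * ((1 + q * t) ^+ #|[pred i | U i]| - t ^+ #|[pred i | U i]|).
Proof.
by rewrite (bigID (@col_nz n)) /= mulrDr sum_col_nonzero sum_col_zero addrC.
Qed.

End NewColumn.

(** * Le-diagrams *)

Section LeDiagrams.
Implicit Types k m : nat.

Definition unrestricted k m (lam : {ffun 'I_k -> 'I_m.+1})
    (f : {ffun 'I_k * 'I_m -> bool}) (i : 'I_k) : bool :=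
  [forall j : 'I_m, (in_diagram lam (i, j) && ~~ f (i, j)) ==>
     ~~ [exists i' : 'I_k, (i' < i)%N && f (i', j)]].

Lemma is_partitionP k m (lam : {ffun 'I_k -> 'I_m.+1}) :
  reflect (forall i i' : 'I_k, (i <= i')%N -> (lam i' <= lam i)%N) (is_partition lam).
Proof.
apply: (iffP forallP) => [H i i'|H i].
  by move/(_ i)/forallP/(_ i')/implyP: H.
by apply/forallP => i'; apply/implyP/H.
Qed.

Lemma unrestrictedP k m (lam : {ffun 'I_k -> 'I_m.+1})
    (f : {ffun 'I_k * 'I_m -> bool}) (i : 'I_k) :
  reflect (forall (j : 'I_m) (i' : 'I_k), (j < lam i)%N -> ~~ f (i, j) ->
             (i' < i)%N -> ~~ f (i', j))
          (unrestricted lam f i).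
Proof.
apply: (iffP forallP) => [H j i' jl nf lt|H j].
  move: (H j); rewrite /in_diagram /= jl nf => /existsPn/(_ i').
  by rewrite lt.
apply/implyP => /andP[jl nf]; apply/existsPn => i'; apply/negP => /andP[lt].
by apply/negP; apply: (H j).
Qed.

Lemma is_Le_fillingP k m (lam : {ffun 'I_k -> 'I_m.+1})
    (f : {ffun 'I_k * 'I_m -> bool}) :
  reflect ((forall i j, f (i, j) -> (j < lam i)%N) /\
           (forall (i i' : 'I_k) (j j' : 'I_m), (j < lam i)%N -> ~~ f (i, j) ->
              (i' < i)%N -> (j' < j)%N -> f (i', j) -> ~~ f (i, j')))
          (is_Le_filling lam f).
Proof.
apply: (iffP andP) => -[H1 H2]; split.
- move=> i j fij; apply: contraLR fij => nl.
  by move/forallP/(_ (i, j)): H1; rewrite /in_diagram /= nl.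
- move=> i i' j j' jl nf lti ltj fj; apply/negP => fi.
  move/forallP/(_ (i, j)): H2; rewrite /in_diagram /= jl nf /=.
  by case/nandP => /existsPn; [move/(_ i')|move/(_ j')]; rewrite ?lti ?ltj ?fj ?fi.
- apply/forallP => -[i j]; apply/implyP; apply: contra; exact: H1.
- apply/forallP => -[i j]; apply/implyP => /andP[jl nf].
  apply/negP => /andP[/existsP[i' /andP[lti fj]] /existsP[j' /andP[ltj fi]]].
  by move/negP: (H2 _ _ _ _ jl nf lti ltj fj).
Qed.

Lemma num_onesE k m (f : {ffun 'I_k * 'I_m -> bool}) :
  num_ones f = (\sum_(i < k) #|[pred j | f (i, j)]|)%N.
Proof.
rewrite /num_ones -sum1_card big_mkcond /=.
under [in RHS]eq_bigr => i _ do rewrite -sum1_card big_mkcond /=.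
by rewrite pair_bigA; apply: eq_bigr => -[i j] _; rewrite !inE.
Qed.

Variables (F : fieldType) (q : F).

Definition Le_weight k m (lam : {ffun 'I_k -> 'I_m.+1}) (t : F)
    (f : {ffun 'I_k * 'I_m -> bool}) : F :=
  q ^+ num_ones f * t ^+ #|[pred i | unrestricted lam f i]|.

Definition Le_sum k m (t : F) : F :=
  \sum_(lam : {ffun 'I_k -> 'I_m.+1} | is_partition lam)
    \sum_(f | is_Le_filling lam f) Le_weight lam t f.

Lemma Le_sum_at1 k m : (Le_genpoly F k m).[q] = Le_sum k m 1.
Proof.
rewrite /Le_genpoly /Le_sum horner_sum; apply: eq_bigr => lam _.
rewrite horner_sum; apply: eq_bigr => f _.
by rewrite hornerXn /Le_weight expr1n mulr1.
Qed.

Lemma Le_sum0 m t : Le_sum 0 m t = 1.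
Proof.
have E (T : Type) (P : pred ('I_0 * T)) : P =i pred0 by move=> [[]].
rewrite /Le_sum (big_pred1 [ffun=> ord0]) => [|lam]; last first.
  have -> : lam = [ffun=> ord0] by apply/ffunP => -[].
  by rewrite /= eqxx; apply/is_partitionP => -[].
rewrite (big_pred1 [ffun=> false]) => [|f]; last first.
  have -> : f = [ffun=> false] by apply/ffunP => -[[]].
  by rewrite /= eqxx; apply/is_Le_fillingP; split=> -[].
by rewrite /Le_weight /num_ones !eq_card0 ?mul1r // => -[] // [].
Qed.

(** * Adding an empty row at the bottom *)

Definition add_row k m (f : {ffun 'I_k * 'I_m -> bool}) : {ffun 'I_k.+1 * 'I_m -> bool} :=
  [ffun b => if unlift ord_max b.1 is Some i then f (i, b.2) else false].

Lemma add_row_lift k m (f : {ffun 'I_k * 'I_m -> bool}) i j :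
  add_row f (lift ord_max i, j) = f (i, j).
Proof. by rewrite ffunE /= liftK. Qed.

Lemma add_row_max k m (f : {ffun 'I_k * 'I_m -> bool}) j :
  add_row f (ord_max, j) = false.
Proof. by rewrite ffunE /= unlift_none. Qed.

Lemma is_partition_add_row k m (lam : {ffun 'I_k -> 'I_m.+1}) :
  is_partition (ffun_rcons lam ord0) = is_partition lam.
Proof.
apply/is_partitionP/is_partitionP => H i i' le.
  by have := H (lift ord_max i) (lift ord_max i'); rewrite !ffun_rcons_lift !lift_max; apply.
move: le; case: (unliftP ord_max i') => [j'|] ->; last by rewrite ffun_rcons_max.
case: (unliftP ord_max i) => [j|] ->; first by rewrite !lift_max !ffun_rcons_lift; apply: H.
by rewrite lift_max leqNgt ltn_ord.
Qed.

Lemma is_Le_filling_add_row k m (lam : {ffun 'I_k -> 'I_m.+1})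
    (f : {ffun 'I_k * 'I_m -> bool}) :
  is_Le_filling (ffun_rcons lam ord0) (add_row f) = is_Le_filling lam f.
Proof.
apply/is_Le_fillingP/is_Le_fillingP => -[H1 H2]; split.
- by move=> i j; have := H1 (lift ord_max i) j; rewrite add_row_lift ffun_rcons_lift.
- move=> i i' j j'; have := H2 (lift ord_max i) (lift ord_max i') j j'.
  by rewrite !add_row_lift ffun_rcons_lift !lift_max.
- move=> i j; case: (unliftP ord_max i) => [i0|] ->; last by rewrite add_row_max.
  by rewrite add_row_lift ffun_rcons_lift; apply: H1.
- move=> i i' j j'; case: (unliftP ord_max i) => [i0|] ->; last by rewrite ffun_rcons_max.
  case: (unliftP ord_max i') => [i1|] ->; last by rewrite !add_row_max.
  by rewrite !add_row_lift ffun_rcons_lift !lift_max; apply: H2.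
Qed.

Lemma Le_weight_add_row k m (lam : {ffun 'I_k -> 'I_m.+1}) t
    (f : {ffun 'I_k * 'I_m -> bool}) :
  Le_weight (ffun_rcons lam ord0) t (add_row f) = t * Le_weight lam t f.
Proof.
rewrite /Le_weight (card_lift ord_max) /=.
have -> : unrestricted (ffun_rcons lam ord0) (add_row f) ord_max.
  by apply/unrestrictedP => j i'; rewrite ffun_rcons_max.
have -> : num_ones (add_row f) = num_ones f.
  rewrite !num_onesE (bigD1_ord ord_max) //= eq_card0 => [|j]; last by rewrite inE add_row_max.
  by apply: eq_bigr => i _; apply: eq_card => j; rewrite !inE add_row_lift.
rewrite exprS mulrCA; congr (_ * (_ * _ ^+ _)); apply: eq_card => i; rewrite !inE.
apply/unrestrictedP/unrestrictedP => H j i'.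
  by have := H j (lift ord_max i'); rewrite !add_row_lift ffun_rcons_lift !lift_max.
case: (unliftP ord_max i') => [i1|] ->; last by rewrite add_row_max.
by rewrite !add_row_lift ffun_rcons_lift !lift_max; apply: H.
Qed.

Lemma Le_sum_last_row0 k m t :
  \sum_(lam : {ffun 'I_k.+1 -> 'I_m.+1} | is_partition lam && (lam ord_max == ord0))
    \sum_(f | is_Le_filling lam f) Le_weight lam t f = t * Le_sum k m t.
Proof.
rewrite (reindex_onto (fun lam => ffun_rcons lam ord0) (@ffun_belast k _)) /=; last first.
  by move=> lam /andP[_ /eqP <-]; rewrite ffun_belastK.
rewrite /Le_sum mulr_sumr; apply: eq_big => [lam|lam _].
  by rewrite is_partition_add_row ffun_rcons_max ffun_rconsK !eqxx !andbT.
rewrite mulr_sumr (reindex_onto (@add_row k m)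
   (fun f => [ffun b => f (lift ord_max b.1, b.2)])) /=; last first.
  move=> f /is_Le_fillingP[H _]; apply/ffunP => -[i j].
  case: (unliftP ord_max i) => [i0|] ->; first by rewrite add_row_lift ffunE.
  by rewrite add_row_max; apply/esym/negP => /H; rewrite ffun_rcons_max.
apply: eq_big => [f|f _]; last exact: Le_weight_add_row.
rewrite is_Le_filling_add_row; case: eqP => [_|[]]; first by rewrite andbT.
by apply/ffunP => -[i j]; rewrite ffunE add_row_lift.
Qed.

(** * Adding a full column on the left *)

Definition add_col k m (f : {ffun 'I_k * 'I_m -> bool}) (c : {ffun 'I_k -> bool}) :
    {ffun 'I_k * 'I_m.+1 -> bool} :=
  [ffun b => if unlift ord0 b.2 is Some j then f (b.1, j) else c b.1].

Definition add_col_shape k m (lam : {ffun 'I_k -> 'I_m.+1}) : {ffun 'I_k -> 'I_m.+2} :=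
  [ffun i => lift ord0 (lam i)].

Lemma add_col_lift k m (f : {ffun 'I_k * 'I_m -> bool}) c i j :
  add_col f c (i, lift ord0 j) = f (i, j).
Proof. by rewrite ffunE /= liftK. Qed.

Lemma add_col0 k m (f : {ffun 'I_k * 'I_m -> bool}) c i :
  add_col f c (i, ord0) = c i.
Proof. by rewrite ffunE /= unlift_none. Qed.

Lemma add_col_shapeE k m (lam : {ffun 'I_k -> 'I_m.+1}) i :
  add_col_shape lam i = (lam i).+1 :> nat.
Proof. by rewrite ffunE lift0. Qed.

(** A 1 in the new column lies to the left of every old box of its row, so no 0 of that row may have
    a 1 above it. The boxes of the new column have nothing to their left and obey no condition of
    their own. *)
Lemma is_Le_filling_add_col k m (lam : {ffun 'I_k -> 'I_m.+1})
    (f : {ffun 'I_k * 'I_m -> bool}) c :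
  is_Le_filling (add_col_shape lam) (add_col f c) =
  is_Le_filling lam f && col_supp (unrestricted lam f) c.
Proof.
apply/is_Le_fillingP/andP => [[H1 H2]|[/is_Le_fillingP[H1 H2] /forallP H3]].
  split.
    apply/is_Le_fillingP; split=> [i j|i i' j j'].
      by have := H1 i (lift ord0 j); rewrite add_col_lift add_col_shapeE lift0.
    have := H2 i i' (lift ord0 j) (lift ord0 j').
    by rewrite !add_col_lift add_col_shapeE !lift0.
  apply/forallP => i; apply/implyP => ci; apply/unrestrictedP => j i' jl nf lt.
  apply/negP => fj; have := H2 i i' (lift ord0 j) ord0.
  by rewrite !add_col_lift add_col_shapeE !lift0 add_col0 ci => /(_ jl nf lt isT fj).
split=> [i j|i i' j j'].
  case: (unliftP ord0 j) => [j0|] ->; rewrite add_col_shapeE //.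
  by rewrite add_col_lift lift0; apply: H1.
case: (unliftP ord0 j) => [j0|] -> //; rewrite add_col_shapeE lift0.
case: (unliftP ord0 j') => [j1|] ->; rewrite !add_col_lift ?add_col0 ?lift0.
  exact: H2.
move=> jl nf lt _ fj; apply/negP => ci.
by move/implyP/(_ ci)/unrestrictedP/(_ _ _ jl nf lt)/negP: (H3 i).
Qed.

Lemma unrestricted_add_col k m (lam : {ffun 'I_k -> 'I_m.+1})
    (f : {ffun 'I_k * 'I_m -> bool}) c i :
  unrestricted (add_col_shape lam) (add_col f c) i =
  unrestricted lam f i && (c i || ~~ [exists i' : 'I_k, (i' < i)%N && c i']).
Proof.
apply/unrestrictedP/andP => [H|[/unrestrictedP H1 H2] j i'].
  split.
    apply/unrestrictedP => j i'; have := H (lift ord0 j) i'.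
    by rewrite !add_col_lift add_col_shapeE lift0.
  case: (boolP (c i)) => //= nc; apply/existsPn => i'.
  rewrite negb_and -implybE; apply/implyP => lt.
  by have := H ord0 i'; rewrite !add_col0 add_col_shapeE; apply.
case: (unliftP ord0 j) => [j0|] ->; rewrite add_col_shapeE ?lift0 ?add_col_lift ?add_col0.
  exact: H1.
move=> _ nc lt; case/orP: H2 => [ci|/existsPn/(_ i')]; first by rewrite ci in nc.
by rewrite lt.
Qed.

Lemma Le_weight_add_col k m (lam : {ffun 'I_k -> 'I_m.+1}) t
    (f : {ffun 'I_k * 'I_m -> bool}) c :
  Le_weight (add_col_shape lam) t (add_col f c) =
  q ^+ num_ones f * col_weight q t (unrestricted lam f) c.
Proof.
rewrite /Le_weight /col_weight mulrA; congr (_ * _ ^+ _); last first.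
  by apply: eq_card => i; rewrite !inE unrestricted_add_col.
rewrite -exprD; congr (_ ^+ _); rewrite !num_onesE addnC.
have -> : #|[pred i | c i]| = (\sum_i c i)%N.
  by rewrite -sum1_card big_mkcond; apply: eq_bigr => i _; rewrite inE; case: (c i).
rewrite -big_split; apply: eq_bigr => i _ /=.
rewrite (card_lift ord0) add_col0; congr (_ + _)%N.
by apply: eq_card => j; rewrite !inE add_col_lift.
Qed.

(** If the last row is nonempty then all rows are, so the leftmost column is full and can be
    removed, shortening each row by one. Summing over its fillings is [sum_col], applied to the
    unrestricted rows of the remaining filling. *)
Lemma Le_sum_add_col k m t :
  (1 + (q - 1) * t) *
  \sum_(lam : {ffun 'I_k.+1 -> 'I_m.+2} | is_partition lam && (lam ord_max != ord0))
    \sum_(f | is_Le_filling lam f) Le_weight lam t f =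
  (1 + (q - 1) * t) * Le_sum k.+1 m t +
  q * t * (Le_sum k.+1 m (1 + q * t) - Le_sum k.+1 m t).
Proof.
rewrite (reindex_onto (@add_col_shape k.+1 m)
  (fun lam => [ffun i => inord (lam i).-1])) /=; last first.
  move=> lam /andP[/is_partitionP H l0]; apply/ffunP => i; apply/val_inj.
  have lt0 : (0 < lam i)%N.
    by apply: leq_trans (H i ord_max (leq_ord i)); rewrite lt0n.
  rewrite /= add_col_shapeE ffunE inordK ?prednK //.
  by rewrite -ltnS ltn_ord.
rewrite /Le_sum -sumrB !mulr_sumr -big_split.
apply: eq_big => [lam|lam _] /=.
  rewrite -(inj_eq val_inj) /= add_col_shapeE andbT.
  have -> : [ffun i => inord (add_col_shape lam i).-1] = lam.
    by apply/ffunP => i; rewrite ffunE add_col_shapeE /= inord_val.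
  rewrite eqxx andbT; apply/is_partitionP/is_partitionP => H i i' le;
    by have := H i i' le; rewrite !add_col_shapeE.
rewrite -sumrB !mulr_sumr -big_split /=.
rewrite (reindex (fun p : {ffun 'I_k.+1 * 'I_m -> bool} * {ffun 'I_k.+1 -> bool} =>
   add_col p.1 p.2)) /=; last first.
  exists (fun g : {ffun 'I_k.+1 * 'I_m.+1 -> bool} =>
     ([ffun b => g (b.1, lift ord0 b.2)], [ffun i => g (i, ord0)])) => [[f c] _|g _] /=.
    congr (_, _); apply/ffunP; first by move=> [i j]; rewrite ffunE add_col_lift.
    by move=> i; rewrite ffunE add_col0.
  apply/ffunP => -[i j]; case: (unliftP ord0 j) => [j0|] ->.
    by rewrite add_col_lift ffunE.
  by rewrite add_col0 ffunE.
under eq_bigl => p do rewrite is_Le_filling_add_col.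
under eq_bigr => p _ do rewrite Le_weight_add_col.
transitivity (\sum_(f | is_Le_filling lam f)
  \sum_(c | col_supp (unrestricted lam f) c)
    (1 + (q - 1) * t) * (q ^+ num_ones f * col_weight q t (unrestricted lam f) c)).
  by rewrite pair_big_dep.
apply: eq_bigr => f _.
by rewrite -!mulr_sumr mulrCA sum_col /Le_weight; ring.
Qed.

Lemma Le_sumS0 k t : Le_sum k.+1 0 t = t * Le_sum k 0 t.
Proof.
rewrite -Le_sum_last_row0 /Le_sum; apply: eq_bigl => lam.
by rewrite [lam _]ord1 eqxx andbT.
Qed.

(** The two cases of the last boundary step: it adds a row exactly when the bottom row is empty. *)
Lemma Le_sumSS k m t :
  (1 + (q - 1) * t) * Le_sum k.+1 m.+1 t =
  (1 + (q - 1) * t) * (t * Le_sum k m.+1 t + Le_sum k.+1 m t) +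
  q * t * (Le_sum k.+1 m (1 + q * t) - Le_sum k.+1 m t).
Proof.
rewrite [in LHS]/Le_sum (bigID (fun lam : {ffun 'I_k.+1 -> 'I_m.+2} => lam ord_max == ord0)) /=.
by rewrite mulrDr Le_sum_add_col Le_sum_last_row0; ring.
Qed.

End LeDiagrams.

(** * Extraction of coefficients *)

Section Grassmannian.
Variables (F : fieldType) (q : F).
Hypothesis q_neq0 : q != 0.

(* The unrestricted rows have weight [t = [m + 1]], so that [Le_poly n m] is [P_n(m + 1)]. *)
Definition Le_poly (n m : nat) : {poly F} :=
  \poly_(k < n.+1) Le_sum q k (n - k) (qnat q m.+1).

Lemma Le_poly0 m : Le_poly 0 m = 1.
Proof.
apply/polyP => -[|k]; rewrite coef_poly coef1 //=.
by rewrite subn0 Le_sum0.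
Qed.

Lemma Le_poly_rec n m :
  Le_poly n.+1 m =
    ((qnat q m.+1)%:P * 'X - (q ^- m * qnat q m)%:P) * Le_poly n m
    + (q ^- m * qnat q m.+1)%:P * Le_poly n m.+1.
Proof.
have qm : q ^+ m != 0 by rewrite expf_neq0.
apply/polyP => k; rewrite coefD mulrBl coefB -mulrA !coefCM coefXM !coef_poly.
case: k => [|k] /=.
  by rewrite !Le_sum0 qnatS; field; rewrite qm.
rewrite !ltnS; case: (ltngtP k n) => kn.
- have := Le_sumSS q k (n - k.+1) (qnat q m.+1).
  rewrite qnat_geom -qnatS_l subnSK // subSS => H.
  (* At t = [m+1] the factor 1 + (q - 1) t is q^(m+1), which can be cancelled. *)
  apply: (@mulfI _ (q ^+ m.+1)); first by rewrite expf_neq0.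
  have -> : qnat q m = qnat q m.+1 - q ^+ m by rewrite qnatS addrK.
  by rewrite H exprS; field; rewrite qm.
- by rewrite !mulr0 subr0 addr0.
(* Here the diagrams have no columns, so only the row step contributes. *)
- by rewrite kn !subSS subnn Le_sumS0 !mulr0 subr0 addr0.
Qed.

(** At m = 0 the weight t is [1] = 1, which forgets the unrestricted rows. *)
Lemma Akn_coef k n : (Akn F k n).[q] = (Le_poly n 0)`_k.
Proof.
rewrite /Akn coef_poly ltnS; case: ifP => _; last by rewrite horner0.
by rewrite Le_sum_at1 qnat1.
Qed.

Lemma Akn_expansion k n : (Akn F k n).[q] =
    \sum_(j < k.+1) q ^- (j * j) * (mu q j ^+ n)`_(k - j)
    - \sum_(j < k) q ^- (j * j + 2 * j + 1) * (mu q j ^+ n)`_(k - j - 1).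
Proof.
by rewrite Akn_coef (coef_eigen_expansion q_neq0 Le_poly0 Le_poly_rec).
Qed.

Lemma coef_mu0_exp n r : (mu q 0 ^+ n)`_r = (r == 0%N)%:R.
Proof.
rewrite coef_mu_exp qnat1 qnat0 mulr0 oppr0 expr1n mulr1.
by case: r => [|r]; rewrite ?expr0 ?bin0 ?mul1r // exprS mul0r mulr0.
Qed.

(** * Coefficients of the power series in the statement *)

Lemma psmul_psX r (b : nat -> F) n :
  psmul (psX F r) b n = if (r <= n)%N then b (n - r)%N else 0.
Proof.
rewrite /psmul /psX.
under eq_bigr => j _ do rewrite mulr_natl mulrb.
rewrite -big_mkcond /=; case: leqP => rn.
  by rewrite (big_pred1 (Ordinal (rn : (r < n.+1)%N))) // => j; rewrite -val_eqE.
rewrite big_pred0 // => j; apply/negP => /eqP jr.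
by move: (ltn_ord j); rewrite jr ltnS leqNgt rn.
Qed.

(** The negative binomial series for (1 - c x)^(-r-1). Multiplication by 1/(1 - c x) is a
    first-order recursion on coefficients, and Pascal's rule solves it. *)
Lemma psexp_geom (c : F) r n : psexp (geom c) r.+1 n = 'C(n + r, r)%:R * c ^+ n.
Proof.
have psmul_geomS b i : psmul (geom c) b i.+1 = b i.+1 + c * psmul (geom c) b i.
  rewrite /psmul big_ord_recl mulr_sumr /geom expr0 mul1r subn0; congr (_ + _).
  by apply: eq_bigr => j _; rewrite lift0 subSS exprS mulrA.
have psmul_geom0 b : psmul (geom c) b 0%N = b 0%N.
  by rewrite /psmul big_ord1 /geom expr0 mul1r.
elim: r n => [|r IHr]; rewrite /psexp iterS -/(psexp _ _).
  elim=> [|n IHn]; first by rewrite psmul_geom0 bin0 mulr1.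
  by rewrite psmul_geomS IHn !bin0 exprS; rewrite /psexp /= /psone /=; ring.
elim=> [|n IHn]; first by rewrite psmul_geom0 IHr !add0n !binn.
by rewrite psmul_geomS IHn IHr addSnnS [(n.+1 + r.+1)%N]addSn binS natrD !exprS; ring.
Qed.

Lemma coef_monomial_geom (c : F) r n :
  psmul (psX F r) (psexp (geom c) r.+1) n = 'C(n, r)%:R * c ^+ (n - r).
Proof.
rewrite psmul_psX psexp_geom; case: leqP => rn; first by rewrite subnK.
by rewrite bin_small // mul0r.
Qed.

(** The denominator factors as q^i (1 - x mu_i), so its inverse is a geometric series in x mu_i. *)
Lemma Ginv_coef i n k : Ginv q i n k = q ^- i * (mu q i ^+ n)`_k.
Proof. by rewrite /Ginv coef_monomial_geom coef_mu_exp; ring. Qed.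

Lemma bmul_bY i (b : nat -> nat -> F) n k :
  bmul (bY F i) b n k = if (i <= k)%N then b n (k - i)%N else 0.
Proof.
rewrite /bmul big_ord_recl [X in _ + X]big1 => [|n1 _]; last first.
  by apply: big1 => k1 _; rewrite /bY /= mul0r.
rewrite addr0 subn0.
rewrite -(psmul_psX i (b n)); apply: eq_bigr => k1 _.
by rewrite /bY /psX.
Qed.

Lemma bmul_numerator i c (G : nat -> nat -> F) n k :
  bmul (bmul (bY F i) (fun n' k' => bconst c n' k' - bY F 1 n' k')) G n k =
  c * bmul (bY F i) G n k - bmul (bY F i.+1) G n k.
Proof.
have H n' k' : bmul (bY F i) (fun n' k' => bconst c n' k' - bY F 1 n' k') n' k' =
    c * bY F i n' k' - bY F i.+1 n' k'.
  rewrite bmul_bY /bconst /bY subn_eq0; case: (n' == 0%N) => /=; last first.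
    by rewrite mulr0n mulr0 subr0; case: ifP.
  case: leqP => [/subnKC <-|ki]; last first.
    by rewrite (ltn_eqF ki) (ltn_eqF (leqW ki)) mulr0n mulr0 subr0.
  move: (k' - i)%N => d; rewrite addKn -[in i.+1]addn1 eqn_add2l.
  rewrite -[X in (_ <= X)%N]addn0 -[X in c * (_ == X)%:R]addn0 leq_add2l eqn_add2l leqn0.
  by case: eqP => _; rewrite ?mulr1 ?mulr0n ?mulr0.
move: H; set B := bmul (bY F i) (fun _ _ => _); move: B => B H.
rewrite /bmul mulr_sumr -sumrB; apply: eq_bigr => n1 _.
rewrite mulr_sumr -sumrB; apply: eq_bigr => k1 _.
by rewrite H mulrBl mulrA.
Qed.

Lemma qint_opp n : qint q (- n%:Z) = - (q ^- n * qnat q n).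
Proof.
case: n => [|n]; first by rewrite oppr0 /= qnat0 mulr0 oppr0.
rewrite -NegzE /=; congr (- _); elim: n => [|n IHn].
  by rewrite big_ord1 qnat1 mulr1.
rewrite big_ord_recr /= IHn (qnatS_l _ n.+1) !exprS.
have qn : q ^+ n != 0 by rewrite expf_neq0.
by field; rewrite q_neq0 qn.
Qed.

(** * The stated formulas, read off from [Akn_expansion] *)

Lemma Akn_generating n k M : (k < M)%N ->
  (if (1 <= k)%N then (Akn F k n).[q] else 0) =
    - q^-1 * bmul (bY F 1) (bofx (geom (1 : F))) n k
    + \sum_(1 <= i < M)
        q ^- (i * i + i + 1)%N *
        bmul (bmul (bY F i) (fun n' k' => bconst (q ^+ (2 * i + 1)%N) n' k' - bY F 1 n' k'))
             (Ginv q i) n k.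
Proof.
move=> kM.
pose T i := (if (i <= k)%N then q ^- (i * i) * (mu q i ^+ n)`_(k - i) else 0)
  - (if (i < k)%N then q ^- (i * i + 2 * i + 1) * (mu q i ^+ n)`_(k - i - 1) else 0).
rewrite (eq_bigr T) => [|i _]; last first.
  rewrite bmul_numerator !bmul_bY !Ginv_coef /T subnS subn1.
  have qi j : q ^+ j != 0 by rewrite expf_neq0.
  rewrite mulrBr; congr (_ - _); case: ifP => _; rewrite ?mulr0 //.
    rewrite mul2n -addnn !exprD expr1; field; rewrite q_neq0 !qi //.
  by rewrite mul2n -addnn !exprD expr1; field; rewrite q_neq0 !qi.
rewrite bmul_bY /bofx.
(* At y^0 the left side is 0 by convention, and the term of index [i >= 1] starts at y^i. *)
case: k kM @T => [|k] kM T /=.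
  rewrite mulr0 add0r big_nat big1 // => i /andP[i0 _].
  by rewrite /T leqNgt i0 /= subr0.
have -> : (Akn F k.+1 n).[q] = \sum_(0 <= i < M) T i.
  rewrite Akn_expansion /T sumrB; congr (_ - _).
    rewrite -(big_mkord xpredT (fun j => q ^- (j * j) * (mu q j ^+ n)`_(k.+1 - j))).
    rewrite (big_nat_widen _ _ _ _ _ kM) big_mkcond /=.
    by apply: eq_bigr => i _; rewrite ltnS.
  rewrite -(big_mkord xpredT (fun j => q ^- (j * j + 2 * j + 1) * (mu q j ^+ n)`_(k.+1 - j - 1))).
  by rewrite (big_nat_widen _ _ _ _ _ (ltnW kM)) big_mkcond /=.
(* Since [mu q 0] is the constant 1, index 0 contributes beyond y^0 only at y^1; this is the
   separate term -y/(q(1-x)). *)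
rewrite [in LHS]big_ltn ?(leq_trans _ kM) //; congr (_ + _).
rewrite /T /= !coef_mu0_exp subn0 subn1 /= mulr0 sub0r muln0 !add0n expr1.
by rewrite mulNr; case: ifP => _; rewrite ?mulr0 // /geom expr1n.
Qed.

Lemma Akn_series k n :
  (Akn F k n).[q] =
     \sum_(i < k)
        (-1) ^+ (i + k) * q ^- (k * i + i + 1)%N * qnat q i ^+ (k - i - 1)%N *
        psmul (psX F (k - i - 1)%N) (psexp (geom (qnat q i.+1)) (k - i)%N) n
   + \sum_(i < k.+1)
        (-1) ^+ (i + k) * q ^- (k * i)%N * qnat q i ^+ (k - i)%N *
        psmul (psX F (k - i)%N) (psexp (geom (qnat q i.+1)) (k - i + 1)%N) n.
Proof.
rewrite Akn_expansion addrC -sumrN; congr (_ + _).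
  apply: eq_bigr => -[i /= ik] _.
  (* Writing [k] as a sum removes the truncated subtractions and reduces the sign to the parity of
     [d]. *)
  have [d ->] : exists d, k = (d.+1 + i)%N by exists (k - i - 1)%N; lia.
  rewrite addnK subn1 /= coef_monomial_geom coef_mu_exp (exprNn (_ * _)) exprMn.
  have -> : (-1) ^+ (i + (d.+1 + i)) = - (-1) ^+ d :> F.
    by rewrite addnCA addnn exprD -(signr_odd _ i.*2) odd_double exprS; ring.
  have -> : ((d.+1 + i) * i + i + 1 = i * i + 2 * i + 1 + i * d)%N by lia.
  by rewrite exprVn -exprM (exprD _ (_ + _ + _)%N) invfM; ring.
apply: eq_bigr => -[i /= ik] _.
have [d ->] : exists d, k = (d + i)%N by exists (k - i)%N; lia.
rewrite addnK addn1 coef_monomial_geom coef_mu_exp (exprNn (_ * _)) exprMn.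
have -> : (-1) ^+ (i + (d + i)) = (-1) ^+ d :> F.
  by rewrite addnCA addnn exprD -(signr_odd _ i.*2) odd_double mulr1.
have -> : ((d + i) * i = i * i + i * d)%N by lia.
by rewrite exprVn -exprM exprD invfM; ring.
Qed.

(** Index 0 of the first sum vanishes because mu_0 = 1 and k > 0. Substituting j = k - i in the
    first sum and j = k - i - 1 in the second gives both the power q^(-(k-i)^2) and the coefficient
    of y^i. *)
Lemma Akn_binomial k n : (1 <= k)%N ->
  (Akn F k n).[q] =
  \sum_(i < k) 'C(n, i)%:R * q ^- ((k - i) * (k - i)) *
    ((- (q ^- (k - i) * qnat q (k - i))) ^+ i * qnat q (k - i + 1) ^+ (n - i)
     - (- (q ^- (k - i - 1) * qnat q (k - i - 1))) ^+ i * qnat q (k - i) ^+ (n - i)).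
Proof.
move=> k0; rewrite Akn_expansion big_ord_recl coef_mu0_exp subn0 (gtn_eqF k0) mulr0 add0r.
rewrite -sumrB (reindex_inj rev_ord_inj); apply: eq_bigr => -[i ik] _ /=.
rewrite /bump /= add1n.
have -> : (k - i.+1).+1 = (k - i)%N by lia.
have -> : (k - (k - i.+1) - 1 = i)%N by lia.
have -> : (k - (k - i) = i)%N by lia.
have -> : ((k - i.+1) * (k - i.+1) + 2 * (k - i.+1) + 1 = (k - i) * (k - i))%N.
  by rewrite -(subnSK ik); lia.
rewrite !coef_mu_exp addn1 -subnDA addn1.
have -> : (k - i.+1).+1 = (k - i)%N by lia.
by ring.
Qed.

End Grassmannian.

Theorem mainTheorem2 (F : fieldType) (q : F) (hq : q != 0) :
  (* A(q,x,y) = -y/(q(1-x)) + sum_{i>=1} y^i (q^(2i+1) - y) / (q^(i^2+i+1) (q^i - q^i[i+1]x + [i]xy)),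
     the infinite sum converging coefficientwise *)
  (forall n k : nat, exists M : nat, forall M' : nat, (M <= M')%N ->
     (if (1 <= k)%N then (Akn F k n).[q] else 0) =
       - q^-1 * bmul (bY F 1) (bofx (geom (1 : F))) n k
       + \sum_(1 <= i < M')
           q ^- (i * i + i + 1)%N *
           bmul (bmul (bY F i) (fun n' k' => bconst (q ^+ (2 * i + 1)%N) n' k' - bY F 1 n' k'))
                (Ginv q i) n k)
  /\
  (* A_k(q,x) = sum_n A_{k,n}(q) x^n *)
  (forall k : nat, (1 <= k)%N -> forall n : nat,
     (Akn F k n).[q] =
       \sum_(i < k)
          (-1) ^+ (i + k) * q ^- (k * i + i + 1)%N * qnat q i ^+ (k - i - 1)%N *
          psmul (psX F (k - i - 1)%N) (psexp (geom (qnat q i.+1)) (k - i)%N) n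
     + \sum_(i < k.+1)
          (-1) ^+ (i + k) * q ^- (k * i)%N * qnat q i ^+ (k - i)%N *
          psmul (psX F (k - i)%N) (psexp (geom (qnat q i.+1)) (k - i + 1)%N) n)
  /\
  (forall k n : nat, (1 <= k)%N ->
     (Akn F k n).[q] =
       q ^- (k * k)%N * \sum_(i < k) (-1) ^+ i * ('C(n, i))%:R *
         (q ^+ (k * i)%N * qnat q (k - i)%N ^+ i * qnat q (k - i + 1)%N ^+ (n - i)%N
          - q ^+ ((k + 1) * i)%N * qnat q (k - i - 1)%N ^+ i * qnat q (k - i)%N ^+ (n - i)%N))
  /\
  (forall k n : nat, (1 <= k)%N ->
     (Akn F k n).[q] =
       \sum_(i < k) ('C(n, i))%:R * q ^- ((k - i) * (k - i))%N *
         (qint q (i%:Z - k%:Z) ^+ i * qnat q (k - i + 1)%N ^+ (n - i)%N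
          - qint q (i%:Z - k%:Z + 1) ^+ i * qnat q (k - i)%N ^+ (n - i)%N)).
Proof.
(* The term of index [i] is divisible by y^i, so indices above [k] contribute nothing. *)
split; first by move=> n k; exists k.+1 => M kM; apply: Akn_generating.
split; first by move=> k _ n; apply: Akn_series.
split=> k n k0; rewrite Akn_binomial //; last first.
  apply: eq_bigr => -[i ik] _ /=.
  have -> : i%:Z - k%:Z = - (k - i)%N%:Z by lia.
  have -> : - (k - i)%N%:Z + 1 = - (k - i - 1)%N%:Z by lia.
  by rewrite !qint_opp.
rewrite mulr_sumr; apply: eq_bigr => -[i ik] _ /=.
rewrite 2!(exprNn (_ * _)) 2!exprMn !exprVn -!exprM.
have -> : (k = (k - i - 1).+1 + i)%N by lia.
move: (k - i - 1)%N => d; rewrite addnK subn1 addn1 /=.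
(* With d + 1 = k - i, the powers of q match by k^2 = (k-i)^2 + (k-i) i + k i. *)
have -> : ((d.+1 + i) * (d.+1 + i) = d.+1 * d.+1 + d.+1 * i + (d.+1 + i) * i)%N by lia.
have -> : ((d.+1 + i + 1) * i = (d.+1 + i) * i + i)%N by lia.
have -> : (d.+1 * i = d * i + i)%N by lia.
have qi j : q ^+ j != 0 by rewrite expf_neq0.
rewrite !exprD.
by field; rewrite !qi.
Qed.
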